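(* Let $N\ge 1$, let $(a,A)\in Z_N$ and let $\Omega(a,A)=(b,B)$. Then for any real $t>0$ and $T>0$, $$\Omega(ta,TA)=\left(\tfrac{T}{t}\,b,\;TB\right),$$ where $ta=(ta_1,\dots,ta_N)$, $TA=(TA_1,\dots,TA_N)$, and similarly for $\tfrac{T}{t}b$ and $TB$.
   Context: Let $N\ge 1$ be a natural number. $Z_N$ denotes the set of all pairs $(a,A)$ where $a=(a_1,\dots,a_N)$ consists of distinct positive real numbers listed in increasing order, $0<a_1<a_2<\dots<a_N$, and $A=(A_1,\dots,A_N)$ consists of positive real numbers (in no particular order, not necessarily distinct). For $(a,A)\in Z_N$, the weighted Cauchy matrix is the $N\times N$ matrix $$\mathcal{C}_{a,A}=\left\{\frac{\sqrt{A_jA_k}}{a_k+a_j}\right\}_{j,k=1}^N,$$ and $v_A=(\sqrt{A_1},\dots,\sqrt{A_N})\in\mathbb{C}^N$. The matrix $\mathcal{C}_{a,A}$ is positive definite and $v_A$ is a cyclic vector for it (the vectors $\mathcal{C}_{a,A}^n v_A$, $n\ge 0$, span $\mathbb{C}^N$), so $\mathcal{C}_{a,A}$ has $N$ distinct positive eigenvalues. The spectral map $\Omega:Z_N\to Z_N$ is defined by $\Omega(a,A)=(b,B)$, where $b=(b_1,\dots,b_N)$ are the eigenvalues of $\mathcal{C}_{a,A}$ listed in increasing order, and $B=(B_1,\dots,B_N)$ with $B_k=|\langle v_A,f_k\rangle|^2$, where $f_k$ is an eigenvector of $\mathcal{C}_{a,A}$ for the eigenvalue $b_k$, normalised to have Euclidean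 norm $1$, and $\langle\cdot,\cdot\rangle$ is the standard Euclidean inner product on $\mathbb{C}^N$. ($B_k$ does not depend on the choice of $f_k$, and $B_k>0$.) *)

(* Defs.v *)
From HB Require Import structures.
From mathcomp Require Import all_boot all_order perm all_algebra.
From mathcomp Require Import boolp reals.
From mathcomp Require Import complex ring.

Set Implicit Arguments.
Unset Strict Implicit.
Unset Printing Implicit Defensive.

Import Order.TTheory GRing.Theory Num.Theory.
Local Open Scope ring_scope.
Local Open Scope complex_scope.

(* Pairs p = (a, A) with 0 < a_1 < ... < a_N and every A_i > 0. *)
Definition in_ZN (R : realType) (N : nat) (p : 'rV[R]_N * 'rV[R]_N) : bool :=
  [&& [forall i, 0 < p.1 0 i],
      [forall i : 'I_N, [forall j : 'I_N, (i < j)%N ==> (p.1 0 i < p.1 0 j)]]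
    & [forall i, 0 < p.2 0 i]].

Record ZN (R : realType) (N : nat) : Type := MkZN {
  ZNval : 'rV[R]_N * 'rV[R]_N;
  ZNvalP : in_ZN ZNval }.

HB.instance Definition _ (R : realType) (N : nat) :=
  [isSub for @ZNval R N].

Definition cauchy_mx (R : realType) (N : nat) (a A : 'rV[R]_N) : 'M[R[i]]_N :=
  \matrix_(j, k) (Num.sqrt (A 0 j * A 0 k) / (a 0 k + a 0 j))%:C.

Definition sqrt_vec (R : realType) (N : nat) (A : 'rV[R]_N) : 'rV[R[i]]_N :=
  \row_j (Num.sqrt (A 0 j))%:C.

Definition inner (R : realType) (N : nat) (u w : 'rV[R[i]]_N) : R[i] :=
  dotmx u w.

(* Elements of C^N are row vectors (as [dotmx] expects), transposed when a
   matrix acts on them from the left. *)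
Definition unit_eigenvector (R : realType) (N : nat) (M : 'M[R[i]]_N)
    (l : R[i]) (f : 'rV[R[i]]_N) : Prop :=
  M *m f^T = l *: f^T /\ inner f f = 1.

(* [w] is (b, B): strictly increasing by membership in [ZN], so the first clause
   says that b lists all the complex eigenvalues; the second holds for every
   normalised eigenvector. The clauses determine [w] for every [z]: see
   [spectral_data_exists] and [spectral_data_uniq]. *)
Definition spectral_data (R : realType) (N : nat) (z w : ZN R N) : Prop :=
  let M := cauchy_mx (ZNval z).1 (ZNval z).2 in
  let v := sqrt_vec (ZNval z).2 in
  let b := (ZNval w).1 in
  let B := (ZNval w).2 in
  (forall l : R[i], eigenvalue M l <-> exists k, l = (b 0 k)%:C) /\
  (forall (k : 'I_N) (f : 'rV[R[i]]_N),
     unit_eigenvector M (b 0 k)%:C f -> (B 0 k)%:C = `|inner v f| ^+ 2).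

Section WellDefined.
Variables (R : realType) (N : nat) (a A : 'rV[R]_N).
Hypothesis haA : in_ZN (a, A).

Local Notation M := (cauchy_mx a A).
Local Notation v := (sqrt_vec A).

Let a_gt0 i : 0 < a 0 i.
Proof. by case/and3P: haA => /forallP. Qed.

Let A_gt0 i : 0 < A 0 i.
Proof. by case/and3P: haA => _ _ /forallP. Qed.

Let a_lt (i j : 'I_N) : (i < j)%N -> a 0 i < a 0 j.
Proof. by case/and3P: haA => _ /forallP/(_ i)/forallP/(_ j)/implyP. Qed.

Lemma cauchy_mxE j k : M j k = v 0 j * v 0 k / (a 0 k + a 0 j)%:C.
Proof.
by rewrite !mxE sqrtrM ?(ltW (A_gt0 _)) // !rmorphM /= fmorphV.
Qed.

Lemma cauchy_mx_sym j k : M j k = M k j.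
Proof. by rewrite !cauchy_mxE addrC [v 0 j * _]mulrC. Qed.

Lemma conj_realC (x : R) : (x%:C)^*%R = x%:C :> R[i].
Proof. by apply/CrealP; rewrite complex_real. Qed.

Lemma sqrt_vecJ k : (v 0 k)^*%R = v 0 k.
Proof. by rewrite mxE conj_realC. Qed.

Lemma cauchy_mxJ j k : (M j k)^*%R = M j k.
Proof. by rewrite mxE conj_realC. Qed.

Lemma inner_sum (u w : 'rV[R[i]]_N) : inner u w = \sum_k u 0 k * (w 0 k)^*%R.
Proof. by rewrite /inner dotmxE mxE; apply: eq_bigr => k _; rewrite !mxE. Qed.

Lemma innerZ c (u w : 'rV[R[i]]_N) : inner (c *: u) w = c * inner u w.
Proof.
by rewrite !inner_sum mulr_sumr; apply: eq_bigr => k _; rewrite mxE mulrA.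
Qed.

Lemma eigen_entries l (f : 'rV[R[i]]_N) : M *m f^T = l *: f^T ->
  forall j, \sum_k M j k * f 0 k = l * f 0 j.
Proof.
move=> /matrixP Mf j; have := Mf j 0; rewrite !mxE => <-.
by apply: eq_bigr => k _; rewrite [f^T _ _]mxE.
Qed.

Lemma entries_eigen l (f : 'rV[R[i]]_N) :
  (forall j, \sum_k M j k * f 0 k = l * f 0 j) -> M *m f^T = l *: f^T.
Proof.
move=> Mf; apply/matrixP => j i; rewrite ord1 mxE [RHS]mxE [f^T _ _]mxE -Mf.
by apply: eq_bigr => k _; rewrite [f^T _ _]mxE.
Qed.

Lemma cauchy_lyapunov j k : ((a 0 k)%:C + (a 0 j)%:C) * M j k = v 0 j * v 0 k.
Proof.
rewrite cauchy_mxE mulrC -rmorphD mulfVK //=.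
by rewrite -(rmorph0 (real_complex R)) (inj_eq (@complexI R)) gt_eqF // addr_gt0.
Qed.

Lemma inner_sqrt (f : 'rV[R[i]]_N) : \sum_k v 0 k * f 0 k = (inner v f)^*%R.
Proof.
rewrite inner_sum rmorph_sum; apply: eq_bigr => k _.
by rewrite rmorphM /= sqrt_vecJ conjCK.
Qed.

Let q (f : 'rV[R[i]]_N) := \sum_k (a 0 k)%:C * `|f 0 k| ^+ 2.

Let q_gt0 f : f != 0 -> 0 < q f.
Proof.
move=> f0; have q0 k : 0 <= (a 0 k)%:C * `|f 0 k| ^+ 2.
  by rewrite mulr_ge0 ?exprn_ge0 // ler0c ltW.
rewrite lt_def sumr_ge0 ?andbT //; apply: contra f0 => /eqP qf0.
apply/eqP/rowP => k; rewrite mxE.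
have /eqP := qf0; rewrite psumr_eq0 // => /allP/(_ k).
rewrite mem_index_enum mulf_eq0 sqrf_eq0 normr_eq0 => /(_ isT).
rewrite -(rmorph0 (real_complex R)) (inj_eq (@complexI R)) gt_eqF //=.
by move=> /eqP.
Qed.

Lemma eigen_identity (l : R) (f : 'rV[R[i]]_N) : M *m f^T = l%:C *: f^T ->
  2%:R * l%:C * q f = `|inner v f| ^+ 2.
Proof.
move=> /eigen_entries Mf.
have qE : l%:C * q f =
    \sum_j \sum_k (f 0 j)^*%R * f 0 k * ((a 0 j)%:C * M j k).
  rewrite mulr_sumr; apply: eq_bigr => j _.
  transitivity ((f 0 j)^*%R * (a 0 j)%:C * (\sum_k M j k * f 0 k)).
    by rewrite Mf normCK; ring.
  by rewrite mulr_sumr; apply: eq_bigr => k _; ring.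
have qE' : l%:C * q f =
    \sum_j \sum_k (f 0 j)^*%R * f 0 k * ((a 0 k)%:C * M j k).
  have := congr1 (@Num.conj R[i]) qE; rewrite rmorphM /= conj_realC.
  have -> : (q f)^*%R = q f.
    by apply/CrealP/ger0_real/sumr_ge0 => k _;
       rewrite mulr_ge0 ?exprn_ge0 // ler0c ltW.
  move=> ->; rewrite exchange_big /= rmorph_sum; apply: eq_bigr => j _.
  rewrite rmorph_sum; apply: eq_bigr => k _.
  by rewrite !rmorphM /= conjCK conj_realC cauchy_mxJ cauchy_mx_sym; ring.
rewrite -mulrA mulr_natl mulr2n {1}qE qE' -big_split /=.
rewrite normCK -inner_sqrt mulrC.
have -> : inner v f = \sum_k v 0 k * (f 0 k)^*%R by rewrite inner_sum.
rewrite mulrC mulr_suml; apply: eq_bigr => j _.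
rewrite -big_split mulr_sumr; apply: eq_bigr => k _ /=.
by rewrite -mulrDr -mulrDl [(a 0 j)%:C + _]addrC cauchy_lyapunov; ring.
Qed.

Lemma kernel_dot (f : 'rV[R[i]]_N) :
  (forall j, \sum_k M j k * f 0 k = 0) -> \sum_k v 0 k * f 0 k = 0.
Proof.
move=> Mf; have /eigen_identity : M *m f^T = (0 : R)%:C *: f^T.
  by apply: entries_eigen => j; rewrite Mf mul0r.
rewrite mulr0 mul0r => /esym/eqP; rewrite sqrf_eq0 normr_eq0 => /eqP h.
by rewrite inner_sqrt h conjC0.
Qed.

Lemma kernel_stable (f : 'rV[R[i]]_N) : (forall j, \sum_k M j k * f 0 k = 0) ->
  forall n j, \sum_k M j k * ((a 0 k)%:C ^+ n * f 0 k) = 0.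
Proof.
move=> Mf; elim=> [|n IHn] j.
  by rewrite -[RHS](Mf j); apply: eq_bigr => k _; rewrite expr0 mul1r.
pose g := \row_k ((a 0 k)%:C ^+ n * f 0 k).
have gE k : g 0 k = (a 0 k)%:C ^+ n * f 0 k by rewrite mxE.
have Mg i : \sum_k M i k * g 0 k = 0.
  by rewrite -[RHS](IHn i); apply: eq_bigr => k _; rewrite gE.
transitivity (v 0 j * (\sum_k v 0 k * g 0 k)
              - (a 0 j)%:C * (\sum_k M j k * g 0 k)); last first.
  by rewrite kernel_dot // Mg !mulr0 subr0.
rewrite !mulr_sumr -sumrB; apply: eq_bigr => k _.
by rewrite !gE exprS [v 0 j * (_ * _)]mulrA -cauchy_lyapunov; ring.
Qed.

Lemma kernel_trivial (f : 'rV[R[i]]_N) :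
  (forall j, \sum_k M j k * f 0 k = 0) -> f = 0.
Proof.
move=> Mf; pose c : 'rV[R[i]]_N := \row_k (a 0 k)%:C.
pose u : 'cV[R[i]]_N := \col_k (v 0 k * f 0 k).
have Vu : Vandermonde N c *m u = 0.
  apply/matrixP => n i; rewrite ord1 !mxE.
  pose g := \row_k ((a 0 k)%:C ^+ n * f 0 k).
  have /kernel_dot gd : forall j, \sum_k M j k * g 0 k = 0.
    move=> j; rewrite -[RHS](kernel_stable Mf n j).
    by apply: eq_bigr => k _; rewrite [g _ _]mxE.
  rewrite -[RHS]gd; apply: eq_bigr => k _.
  by rewrite [u _ _]mxE [g _ _]mxE !mxE; ring.
have Vunit : Vandermonde N c \in unitmx.
  rewrite unitmxE unitfE det_Vandermonde.
  apply/prodf_neq0 => i _; apply/prodf_neq0 => j ij.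
  rewrite !mxE subr_eq0 (inj_eq (@complexI R)) gt_eqF //; exact: a_lt.
have u0 : u = 0 by rewrite -[u](mulKmx Vunit) Vu mulmx0.
apply/rowP => k; have /matrixP/(_ k 0)/eqP := u0; rewrite !mxE mulf_eq0.
rewrite -{1}(rmorph0 (real_complex R)) (inj_eq (@complexI R)) gt_eqF ?sqrtr_gt0 //=.
by move=> /eqP.
Qed.

Lemma eigen_dot_neq0 (l : R) (f : 'rV[R[i]]_N) :
  M *m f^T = l%:C *: f^T -> f != 0 -> inner v f != 0.
Proof.
move=> Mf f0; apply: contra (f0) => /eqP vf.
have := eigen_identity Mf; rewrite vf normr0 expr0n /= => /eqP.
rewrite !mulf_eq0 pnatr_eq0 (gt_eqF (q_gt0 f0)) orbF /= => /eqP l0.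
by apply/eqP/kernel_trivial => j; rewrite (eigen_entries Mf) l0 mul0r.
Qed.

Lemma eigen_gt0 (l : R) (f : 'rV[R[i]]_N) :
  M *m f^T = l%:C *: f^T -> f != 0 -> 0 < l.
Proof.
move=> Mf f0; rewrite -ltcR -(pmulr_lgt0 _ (q_gt0 f0)).
rewrite -(pmulr_rgt0 _ (ltr0Sn _ 1)) mulrA (eigen_identity Mf).
by rewrite exprn_gt0 // normr_gt0 (eigen_dot_neq0 Mf).
Qed.

Lemma eigen_simple (l : R) (f g : 'rV[R[i]]_N) :
  M *m f^T = l%:C *: f^T -> M *m g^T = l%:C *: g^T ->
  (inner v g)^*%R *: f = (inner v f)^*%R *: g.
Proof.
move=> Mf Mg; apply/eqP; rewrite -subr_eq0; apply: contraT => h0.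
have /eigen_dot_neq0/(_ h0) :
    M *m ((inner v g)^*%R *: f - (inner v f)^*%R *: g)^T
    = l%:C *: ((inner v g)^*%R *: f - (inner v f)^*%R *: g)^T.
  have -> (x y : R[i]) : (x *: f - y *: g)^T = x *: f^T - y *: g^T.
    by apply/matrixP => i j; rewrite !mxE.
  rewrite mulmxBr -!scalemxAr Mf Mg scalerBr.
  by rewrite !scalerA; congr (_ *: _ - _ *: _); rewrite mulrC.
rewrite -(inj_eq (can_inj (@conjCK _))) conjC0 -inner_sqrt.
under eq_bigr => k _ do rewrite !mxE mulrBr !(mulrCA (Num.sqrt _)%:C).
rewrite sumrB -!mulr_sumr.
have E (h : 'rV[R[i]]_N) : \sum_k (Num.sqrt (A 0 k))%:C * h 0 k = (inner v h)^*%R.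
  by rewrite -inner_sqrt; apply: eq_bigr => k _; rewrite mxE.
by rewrite !E mulrC subrr eqxx.
Qed.

Lemma cauchy_hermsym : M \is hermsymmx.
Proof.
apply: realsym_hermsym.
  apply/is_hermitianmxP; rewrite expr0 scale1r.
  by apply/matrixP => i j; rewrite [RHS]mxE [in RHS]mxE /= cauchy_mx_sym.
by apply/mxOverP => i j; apply/CrealP; rewrite cauchy_mxJ.
Qed.

Lemma cauchy_tr : M^T = M.
Proof. by apply/matrixP => i j; rewrite mxE cauchy_mx_sym. Qed.

Lemma cauchy_spectral : exists (P : 'M[R[i]]_N) (d : 'rV[R]_N),
  [/\ forall i, unit_eigenvector M (d 0 i)%:C (row i P),
      forall l, eigenvalue M l <-> exists i, l = (d 0 i)%:C
    & injective (d 0)].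
Proof.
have Mh := cauchy_hermsym.
pose P : 'M[R[i]]_N := spectralmx M; pose s : 'rV[R[i]]_N := spectral_diag M.
have sr i : (complex.Re (s 0 i))%:C = s 0 i.
  by apply: RRe_real; have /mxOverP := hermitian_spectral_diag_real Mh; apply.
pose d : 'rV[R]_N := \row_i complex.Re (s 0 i).
have dE i : (d 0 i)%:C = s 0 i by rewrite mxE sr.
have ME : M = invmx P *m diag_mx s *m P.
  exact/orthomx_spectralP/hermitian_normalmx.
have PM : P *m M = diag_mx s *m P.
  by rewrite ME !mulmxA mulmxV ?spectral_unit // mul1mx.
have rowPM i : row i P *m M = s 0 i *: row i P.
  by rewrite -row_mul PM row_mul row_diag_mx -scalemxAl -rowE.
have Pu i j : inner (row i P) (row j P) = (i == j)%:R.
  exact: (row_unitarymxP (spectral_unitarymx M)).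
have ev i : unit_eigenvector M (d 0 i)%:C (row i P).
  split; last by rewrite Pu eqxx.
  by rewrite -{1}cauchy_tr -trmx_mul rowPM dE linearZ.
have row0 i : row i P != 0.
  apply/eqP => r0; have := Pu i i; rewrite r0 eqxx inner_sum => /eqP.
  by rewrite big1 => [|k _]; rewrite ?mxE ?mul0r // eq_sym oner_eq0.
exists P, d; split => //.
- move=> l; split; last first.
    case=> i ->; apply/eigenvalueP; exists (row i P) => //.
    by rewrite rowPM dE.
  move=> /eigenvalueP[f fM f0].
  pose g := f *m invmx P.
  have gs : g *m diag_mx s = l *: g.
    rewrite /g scalemxAl -fM ME !mulmxA -[RHS]mulmxA.
    by rewrite mulmxV ?spectral_unit // mulmx1.
  have g0 : g != 0.
    by apply: contra f0 => /eqP g0; rewrite -[f](mulmxKV (spectral_unit M)) -/P -/g g0 mul0mx.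
  have /rV0Pn[i gi] := g0.
  exists i; rewrite dE; have /rowP/(_ i) := gs.
  rewrite mul_mx_diag mxE [RHS]mxE mulrC => e.
  by apply/esym; apply: (mulIf gi).
- move=> i j dij; apply/eqP; apply: contraT => ij.
  have [ei _] := ev i; have [ej _] := ev j; rewrite -dij in ej.
  have := eigen_simple ei ej.
  move=> /(congr1 (fun w : 'rV[R[i]]_N => inner w (row i P))).
  rewrite !innerZ !Pu eqxx [j == i]eq_sym (negPf ij) mulr1 mulr0.
  by move=> /eqP; rewrite conjC_eq0 (negPf (eigen_dot_neq0 ej (row0 j))).
Qed.
End WellDefined.

Lemma increasing_reindex (R : realType) (N : nat) (d : 'rV[R]_N) :
  injective (d 0) -> exists s : {perm 'I_N},
    forall i j : 'I_N, (i < j)%N -> d 0 (s i) < d 0 (s j).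
Proof.
move=> dI; pose r := sort (relpre (d 0) <=%R) (enum 'I_N).
have sr : size r = N by rewrite size_sort size_enum_ord.
have ur : uniq r by rewrite sort_uniq enum_uniq.
pose g (i : 'I_N) := nth i r i.
have gI : injective g.
  move=> i j; rewrite /g (set_nth_default i) ?sr // => /eqP.
  by rewrite nth_uniq ?sr // => /eqP/val_inj.
exists (perm gI) => i j ij; rewrite !permE lt_neqAle (inj_eq dI) (inj_eq gI).
rewrite -val_eqE ltn_eqF //= /g (set_nth_default j i) ?sr //.
have rs : sorted (relpre (d 0) <=%R) r by apply: sort_sorted => x y; exact: le_total.
apply: (sorted_leq_nth _ _ j rs); rewrite ?inE ?sr //; last exact: ltnW.
  by move=> x y z; exact: le_trans.
by move=> x; exact: lexx.
Qed.

Lemma spectral_data_exists (R : realType) (N : nat) (z : ZN R N) :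
  exists w, spectral_data z w.
Proof.
case: z => [[a A] haA].
have [P [d [evP evE dI]]] := cauchy_spectral haA.
have [s slt] := increasing_reindex dI.
have row0 i : row i P != 0.
  apply/eqP => r0; have [_] := evP i; rewrite r0 inner_sum => /eqP.
  by rewrite big1 => [|k _]; rewrite ?mxE ?mul0r // eq_sym oner_eq0.
pose b : 'rV[R]_N := \row_k d 0 (s k).
pose B : 'rV[R]_N :=
  \row_k complex.Re (`|inner (sqrt_vec A) (row (s k) P)| ^+ 2).
have BE k : (B 0 k)%:C = `|inner (sqrt_vec A) (row (s k) P)| ^+ 2.
  by rewrite mxE RRe_real // ger0_real // exprn_ge0.
have hbB : in_ZN (b, B).
  apply/and3P; split; apply/forallP => i /=.
  - by rewrite mxE (eigen_gt0 haA (evP _).1 (row0 _)).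
  - by apply/forallP => j; apply/implyP => ij; rewrite !mxE slt.
  - by rewrite -ltcR BE exprn_gt0 // normr_gt0 (eigen_dot_neq0 haA (evP _).1).
exists (MkZN hbB); split => /= [l|k f [Mf f1]].
  rewrite evE; split=> -[i ->].
    by exists ((s^-1)%g i); rewrite mxE permKV.
  by exists (s i); rewrite mxE.
rewrite BE; have [Mg g1] := evP (s k).
have bk : b 0 k = d 0 (s k) by rewrite mxE.
rewrite bk in Mf; have e := eigen_simple haA Mf Mg.
set x := inner _ f in e *; set y := inner _ (row _ _) in e *.
have nE c (u : 'rV[R[i]]_N) : inner (c *: u) (c *: u) = `|c| ^+ 2 * inner u u.
  rewrite !inner_sum mulr_sumr; apply: eq_bigr => i _.
  by rewrite !mxE rmorphM normCK; ring.
have h : `|y^*%R| ^+ 2 = `|x^*%R| ^+ 2.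
  by rewrite -[LHS]mulr1 -f1 -nE e nE g1 mulr1.
by move: h; rewrite !norm_conjC.
Qed.

Lemma spectral_data_uniq (R : realType) (N : nat) (z w w' : ZN R N) :
  spectral_data z w -> spectral_data z w' -> w = w'.
Proof.
case: z => [[a A] haA]; case: w => [[b B] hb]; case: w' => [[b' B'] hb'].
have [P [d [evP evE _]]] := cauchy_spectral haA.
have sorted_row (c C : 'rV[R]_N) : in_ZN (c, C) ->
    sorted <%R [seq c 0 i | i <- enum 'I_N].
  move=> /and3P[_ /forallP clt _]; rewrite sorted_map.
  have := iota_ltn_sorted 0 N; rewrite -val_enum_ord sorted_map.
  apply: sub_sorted => i j ij /=.
  by have /forallP/(_ j)/implyP := clt i; apply.
move=> [/= Eb EB] [/= Eb' EB'].
have bb' : b = b'.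
  have : [seq b 0 i | i <- enum 'I_N] = [seq b' 0 i | i <- enum 'I_N].
    apply: (irr_sorted_eq lt_trans ltxx); [exact: sorted_row hb|exact: sorted_row hb'|].
    move=> x; apply/mapP/mapP => -[k _ ->].
      have /Eb'[j /complexI ->] := (Eb (b 0 k)%:C).2 (ex_intro _ k erefl).
      by exists j; rewrite ?mem_enum.
    have /Eb[j /complexI ->] := (Eb' (b' 0 k)%:C).2 (ex_intro _ k erefl).
    by exists j; rewrite ?mem_enum.
  move=> /eq_in_map bE; apply/rowP => k; apply: bE; exact: mem_enum.
have BB' : B = B'.
  apply/rowP => k; apply: complexI.
  have /evE[i bk] := (Eb (b 0 k)%:C).2 (ex_intro _ k erefl).
  have ev := evP i; rewrite -bk in ev.
  by have ev' := ev; rewrite {1}bb' in ev'; rewrite (EB _ _ ev) (EB' _ _ ev').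
by apply: val_inj; rewrite /= bb' BB'.
Qed.

Definition Omega (R : realType) (N : nat) (z : ZN R N) : ZN R N :=
  sval (cid (spectral_data_exists z)).

Lemma OmegaP (R : realType) (N : nat) (z : ZN R N) : spectral_data z (Omega z).
Proof. exact: svalP. Qed.

Lemma in_ZN_scale (R : realType) (N : nat) (t T : R) (p : 'rV[R]_N * 'rV[R]_N) :
  0 < t -> 0 < T -> in_ZN p -> in_ZN (t *: p.1, T *: p.2).
Proof.
move=> t0 T0 /and3P[/forallP a0 /forallP alt /forallP A0].
apply/and3P; split; apply/forallP => i /=; rewrite ?mxE ?mulr_gt0 //.
apply/forallP => j; apply/implyP => ij; rewrite !mxE ltr_pM2l //.
by have /forallP/(_ j)/implyP := alt i; apply.
Qed.

(* (a, A) |-> (t a, T A) *)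
Definition ZN_scale (R : realType) (N : nat) (t T : R) (ht : 0 < t) (hT : 0 < T)
    (z : ZN R N) : ZN R N :=
  MkZN (in_ZN_scale ht hT (ZNvalP z)).

(* Main.v *)
Require Import Defs.
From mathcomp Require Import all_boot all_order all_algebra.
From mathcomp Require Import reals.
From mathcomp Require Import complex.
Import Order.TTheory GRing.Theory Num.Theory.
Local Open Scope ring_scope.
Local Open Scope complex_scope.

(** Replacing (a, A) by (ta, TA) multiplies the Cauchy matrix by T/t and the vector v by sqrt T.
    Unit eigenvectors are therefore unchanged, eigenvalues are multiplied by T/t > 0, which
    preserves their order, and each |<v, f>|^2 by T. [spectral_data_scale] is this statement for the
    relation [spectral_data]; uniqueness transfers it to [Omega]. *)

Lemma cauchy_mx_scale (R : realType) (N : nat) (a A : 'rV[R]_N) (t T : R) :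
  0 <= T -> cauchy_mx (t *: a) (T *: A) = (T / t)%:C *: cauchy_mx a A.
Proof.
move=> T0; apply/matrixP => j k; rewrite !mxE -rmorphM /=; congr (_ %:C).
(* The numerator is sqrt (T^2 A_j A_k), and sqrt (T^2) = |T| = T. *)
rewrite mulrACA -expr2 sqrtrM ?exprn_ge0 // sqrtr_sqr ger0_norm //.
by rewrite -mulrDr invfM mulrACA.
Qed.

Lemma sqrt_vec_scale (R : realType) (N : nat) (A : 'rV[R]_N) (T : R) :
  0 <= T -> sqrt_vec (T *: A) = (Num.sqrt T)%:C *: sqrt_vec A.
Proof. by move=> T0; apply/rowP => j; rewrite !mxE sqrtrM // rmorphM. Qed.

Lemma eigenvalue_scale (F : fieldType) (n : nat) (M : 'M[F]_n) (c l : F) :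
  c != 0 -> eigenvalue (c *: M) (c * l) = eigenvalue M l.
Proof.
move=> c0; apply/eigenvalueP/eigenvalueP => -[f fM f0]; exists f => //.
  by apply: (scalerI c0); rewrite scalemxAr fM scalerA.
by rewrite -scalemxAr fM scalerA.
Qed.

Lemma spectral_data_scale (R : realType) (N : nat) (z w : ZN R N) (t T : R)
    (ht : 0 < t) (hT : 0 < T) : spectral_data z w ->
  spectral_data (ZN_scale ht hT z) (ZN_scale (divr_gt0 hT ht) hT w).
Proof.
have c0 : (T / t)%:C != 0 by rewrite eq_complex /= eqxx andbT gt_eqF ?divr_gt0.
have scaleC (s : R) (x : 'rV[R]_N) k :
    ((s *: x) 0 k)%:C = s%:C * (x 0 k)%:C.
  by rewrite mxE rmorphM.
move=> [Eb EB]; rewrite /spectral_data /= cauchy_mx_scale ?ltW //.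
rewrite sqrt_vec_scale ?ltW //; split=> [l|k f [Mf f1]].
  (* Writing l as c (l / c) with c = T/t reduces to the eigenvalue l / c of the original matrix. *)
  rewrite -{1}[l](mulVKf c0) eigenvalue_scale // Eb.
  split=> -[k lk]; exists k; first by rewrite scaleC -lk mulVKf.
  by rewrite lk scaleC mulKf.
(* Cancelling c in the eigenvector equation gives back the original one, with the same unit vector
   f. *)
have /EB BE : unit_eigenvector (cauchy_mx (ZNval z).1 (ZNval z).2)
    ((ZNval w).1 0 k)%:C f.
  by split=> //; apply: (scalerI c0); rewrite scalemxAl Mf scaleC scalerA.
rewrite scaleC BE innerZ normrM exprMn ger0_norm ?ler0c ?sqrtr_ge0 //.
by congr (_ * _); rewrite -rmorphXn /= sqr_sqrtr ?ltW.
Qed.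

Theorem theorem1p2 (R : realType) (N : nat) (hN : (1 <= N)%N)
    (aA bB : ZN R N) (hO : Omega aA = bB)
    (t T : R) (ht : 0 < t) (hT : 0 < T) :
  Omega (ZN_scale ht hT aA) = ZN_scale (divr_gt0 hT ht) hT bB.
Proof.
(* Both sides are spectral data of the scaled pair. *)
rewrite -hO; apply: spectral_data_uniq (OmegaP _) _.
exact/spectral_data_scale/OmegaP.
Qed.
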